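(* Let $n$ be an even positive integer and $0\le k<n$. Then $$\sum_{w\in\mathscr R_{n,k}}(-1)^{\operatorname{inv}(w)}q^{\operatorname{maj}(w)}=[k+1]_{(-1)^{k}q}\,[k+2]_{(-1)^{k+1}q}\cdots[n-1]_q\,[n]_{-q},$$ that is, the left-hand side equals $\prod_{j=k+1}^{n}[j]_{(-1)^{j-1}q}$.
   Context: For a nonnegative integer $m$ and an expression $x$, $[m]_x=1+x+\cdots+x^{m-1}$. For $0\le k<n$, the rake $R_{n,k}$ is the poset on $n$ elements $x_1,\dots,x_n$ in which $x_i<x_j$ if and only if $i<j$ and $k<j$ (so $x_1,\dots,x_k$, the teeth, are pairwise incomparable minimal elements lying below the chain $x_{k+1}<\cdots<x_n$). A labelling of $R_{n,k}$ is a bijection $w:R_{n,k}\to\{1,\dots,n\}$. For a labelling $w$: $\operatorname{inv}(w)$ is the number of pairs $(x,y)$ with $x<y$ and $w(x)>w(y)$; an element $x$ is a descent of $w$ if $x$ is covered by an element $y$ and $w(x)>w(y)$; $h_x=|\{a: a\le x\}|$ is the hook length of $x$; $\operatorname{maj}(w)=\sum_{x}h_x$, the sum over all descents $x$ of $w$. The group $S_k$ acts on labellings by permuting the labels of the teeth $x_1,\dots,x_k$; this preserves $\operatorname{inv}$ and $\operatorname{maj}$. $\mathscr R_{n,k}$ denotes the set of orbits of labellings of $R_{n,k}$ under this action. *)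

(* Defs.v *)
From HB Require Import structures.
From mathcomp Require Import all_boot all_order all_algebra all_fingroup.

Set Implicit Arguments.
Unset Strict Implicit.
Unset Printing Implicit Defensive.

Import Order.TTheory GRing.Theory.

Section PosetStatistics.
Variables (d : Order.disp_t) (P : finPOrderType d).

Definition covers (x y : P) : bool :=
  (x < y)%O && [forall z : P, ~~ ((x < z)%O && (z < y)%O)].

Definition hook_length (x : P) : nat := #|[set a : P | (a <= x)%O]|.

Definition inv (w : P -> nat) : nat :=
  #|[set p : P * P | (p.1 < p.2)%O && (w p.2 < w p.1)]|.

Definition descent (w : P -> nat) (x : P) : bool :=
  [exists y : P, covers x y && (w y < w x)].

Definition maj (w : P -> nat) : nat :=
  \sum_(x : P | descent w x) hook_length x.

Lemma eq_inv (w w' : P -> nat) : w =1 w' -> inv w = inv w'.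
Proof.
by move=> eqw; apply: eq_card => p; rewrite !inE !eqw.
Qed.

Lemma eq_maj (w w' : P -> nat) : w =1 w' -> maj w = maj w'.
Proof.
move=> eqw; apply: eq_bigl => x.
by apply: eq_existsb => y; rewrite !eqw.
Qed.

Section Automorphism.
Variable s : {perm P}.
Hypothesis s_lt : forall x y, (s x < s y)%O = (x < y)%O.

Lemma inv_aut (w : P -> nat) : inv (fun x => w (s x)) = inv w.
Proof.
pose f (p : P * P) := (s p.1, s p.2).
have f_inj : injective f by move=> [a b] [a' b'] [/perm_inj-> /perm_inj->].
rewrite /inv -[RHS](card_preimset _ f_inj).
by apply: eq_card => p; rewrite !inE /= s_lt.
Qed.

Lemma covers_aut x y : covers (s x) (s y) = covers x y.
Proof.
rewrite /covers s_lt; congr andb; apply/forallP/forallP => h z.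
  by have := h (s z); rewrite !s_lt.
by have := h ((s^-1)%g z); rewrite -s_lt -(s_lt _ y) permKV.
Qed.

Lemma hook_length_aut x : hook_length (s x) = hook_length x.
Proof.
rewrite /hook_length -(card_preimset _ (@perm_inj _ s)).
apply: eq_card => a.
by rewrite !inE !le_eqVlt s_lt (inj_eq perm_inj).
Qed.

Lemma descent_aut (w : P -> nat) x :
  descent (fun x => w (s x)) x = descent w (s x).
Proof.
apply/existsP/existsP => -[y].
  by rewrite -covers_aut => h; exists (s y).
by move=> h; exists ((s^-1)%g y); rewrite -covers_aut permKV.
Qed.

Lemma maj_aut (w : P -> nat) : maj (fun x => w (s x)) = maj w.
Proof.
rewrite /maj [RHS](reindex_inj (@perm_inj _ s)) /=.
by apply: eq_big => x; rewrite ?hook_length_aut ?descent_aut.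
Qed.

End Automorphism.
End PosetStatistics.

(* The element i : rake n k (0 <= i < n) stands for x_{i+1}. *)
Definition rake (n k : nat) : Type := 'I_n.

HB.instance Definition _ n k := Finite.on (rake n k).

Definition rake_lt (n k : nat) (x y : rake n k) : bool :=
  let: (i, j) := ((x : 'I_n).+1, (y : 'I_n).+1) in (i < j) && (k < j).

Lemma rake_lt_irr n k : irreflexive (@rake_lt n k).
Proof. by move=> x; rewrite /rake_lt ltnn. Qed.

Lemma rake_lt_trans n k : transitive (@rake_lt n k).
Proof.
move=> y x z /andP[xy _] /andP[yz kz].
by rewrite /rake_lt (ltn_trans xy yz).
Qed.

Fact rake_display : Order.disp_t. Proof. exact: Order.Disp tt tt. Qed.

HB.instance Definition _ n k :=
  Order.Lt_isPOrder.Build rake_display (rake n k)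
    (@rake_lt_irr n k) (@rake_lt_trans n k).

Lemma rake_ltE n k (x y : rake n k) :
  (x < y)%O = ((x : 'I_n) < (y : 'I_n)) && (k <= (y : 'I_n)).
Proof. by []. Qed.

Definition teeth (n k : nat) : {set 'I_n} := [set x : 'I_n | x < k].

(* A labelling is a permutation w of 'I_n, sending the element x of the rake to
   the label (w x).+1 in {1, ..., n}. *)
Definition label (n k : nat) (w : 'S_n) : rake n k -> nat :=
  fun x => (w x).+1.

(* MathComp composes permutations left to right, so that
   relabel w s x = w ((s^-1)%g x). *)
Definition relabel (n : nat) (w s : 'S_n) : 'S_n := (s^-1 * w)%g.

Lemma relabel1 n (w : 'S_n) : relabel w 1%g = w.
Proof. by rewrite /relabel invg1 mul1g. Qed.

Lemma relabelM n (w s t : 'S_n) : relabel w (s * t)%g = relabel (relabel w s) t.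
Proof. by rewrite /relabel invMg mulgA. Qed.

Definition relabel_action (n : nat) : {action 'S_n &-> 'S_n} :=
  TotalAction (@relabel1 n) (@relabelM n).

(* The group S_k, realized as the permutations of the rake moving only teeth. *)
Definition rake_orbits (n k : nat) : {set {set 'S_n}} :=
  [set orbit (relabel_action n) (Sym (teeth n k)) w | w : 'S_n].

(* The statistics of an orbit are those of an arbitrary member of it; they do
   not depend on the member by rake_invE and rake_majE. *)
Definition rake_inv (n k : nat) (O : {set 'S_n}) : nat :=
  inv (@label n k (repr O)).

Definition rake_maj (n k : nat) (O : {set 'S_n}) : nat :=
  maj (@label n k (repr O)).

Lemma teeth_perm_lt n k (s : 'S_n) : s \in Sym (teeth n k) ->
  forall x y : rake n k, ((s x : rake n k) < (s y : rake n k))%O = (x < y)%O.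
Proof.
rewrite inE => s_on x y; rewrite !rake_ltE.
have le_s z : (k <= s z) = (k <= z).
  have := perm_closed z s_on; rewrite !inE.
  by rewrite !ltnNge => /negb_inj.
have fix_s (z : 'I_n) : k <= z -> s z = z.
  by move=> kz; apply: (out_perm s_on); rewrite inE -leqNgt.
rewrite le_s; have [ky|] := leqP k y; last by rewrite !andbF.
rewrite !andbT (fix_s y) //; have [kx|xk] := leqP k x; first by rewrite fix_s.
by rewrite !(leq_trans _ ky) // ltnNge le_s -ltnNge.
Qed.

Lemma relabel_inv n k (w s : 'S_n) : s \in Sym (teeth n k) ->
  inv (@label n k (relabel w s)) = inv (@label n k w).
Proof.
rewrite -groupV => /teeth_perm_lt/inv_aut aut; rewrite -[RHS]aut.
by apply: eq_inv => x; rewrite /label permM.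
Qed.

Lemma relabel_maj n k (w s : 'S_n) : s \in Sym (teeth n k) ->
  maj (@label n k (relabel w s)) = maj (@label n k w).
Proof.
rewrite -groupV => /teeth_perm_lt/maj_aut aut; rewrite -[RHS]aut.
by apply: eq_maj => x; rewrite /label permM.
Qed.

Lemma rake_invE n k (O : {set 'S_n}) (w : 'S_n) :
  O \in rake_orbits n k -> w \in O -> rake_inv k O = inv (@label n k w).
Proof.
move=> /imsetP[w0 _ ->] wO; rewrite /rake_inv.
have /orbitP[s sS <-] := mem_repr w wO.
by case/orbitP: wO => t tS <-; rewrite !relabel_inv.
Qed.

Lemma rake_majE n k (O : {set 'S_n}) (w : 'S_n) :
  O \in rake_orbits n k -> w \in O -> rake_maj k O = maj (@label n k w).
Proof.
move=> /imsetP[w0 _ ->] wO; rewrite /rake_maj.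
have /orbitP[s sS <-] := mem_repr w wO.
by case/orbitP: wO => t tS <-; rewrite !relabel_maj.
Qed.

Definition qint (R : pzRingType) (m : nat) (x : R) : R :=
  (\sum_(i < m) x ^+ i)%R.

(* Main.v *)
Require Import Defs.
From mathcomp Require Import all_boot all_order all_algebra all_fingroup.
From mathcomp Require Import zify ring.

Set Implicit Arguments.
Unset Strict Implicit.
Unset Printing Implicit Defensive.

Import Order.TTheory GRing.Theory Num.Theory.

(** Write S_n for the set of all labellings of the rake R_{n,k}, with no
    quotient taken.  The group S_k acts freely on it and preserves both
    statistics, so the orbit sum times k! is the sum over S_n
    (sum_rake_orbits), and k! can be cancelled at the end.

    The sum over S_{n+1} is refined by the label a of the top of the chain:
    F_n(a), for 0 <= a <= n, is the part of the sum over labellings whose top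
    label is a (last_sum).  Deleting the top element and standardising the
    remaining labels leaves a labelling of R_{n,k} with some top label b.
    The deleted element formed an inversion with the n - a larger labels, all
    of which sit below it; and the former top, of hook length n, was a descent
    exactly when b >= a.  This gives a linear recursion (last_sum_rec)

      F_{n+1}(a) = (-1)^(n+1-a) sum_b (if b < a then 1 else q^(n+1)) F_n(b),

    starting from F_k(a) = k! (-q)^(k-a), where the top element lies just above
    the k teeth (last_sum_teeth).

    Two families of combinations of the F_n(a) have a closed form whatever the
    parity of k, and they carry the sum.  Let T_n be k! times the product of
    the [j]_{(-1)^(j-1) q} over k < j <= n.  For n = 2h:

      F_n(2i) = T_n q^(n-2i)                                  (even entries)
      F_{n+1}(2i) + F_{n+1}(2i+1) = B q^(n-2i)                (pair sums)

    for 0 <= i <= h, with B independent of i.  In the recursion for F_{n+1} the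
    entries 2i and 2i+1 have opposite signs and their coefficients agree except
    at b = 2i, so a pair sum is (1 - q^(n+1)) F_n(2i): the even entries give
    the pair sums.  In the recursion for F_{n+2}(2i) the coefficient of F_{n+1}
    is constant on each pair {2r, 2r+1}, so the pair sums give the even
    entries.  Either family can start the induction, according to the parity
    of k.  Summing the pair sums gives the sum over S_{n+2}, that is,
    B [h+1]_{q^2}, and the factors of the product come out of
    (1 - q^(2h+1)) [h+1]_{q^2} = [2h+1]_q [2h+2]_{-q}. *)

(** * Both statistics as weighted counts of label inversions *)

(** Both inv and maj add up, over the pairs of elements whose labels are out of
    order, a coefficient that depends on the positions only; treating them
    together makes the removal of the top element a single computation. *)
Definition pair_stat (c : nat -> nat -> nat) n (w : 'S_n) : nat :=
  \sum_(y < n) \sum_(x < n) c x y * (w y < w x).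

Definition inv_coef (k x y : nat) : nat := (x < y) && (k <= y).

(** The element at index x has hook length 1 if it is a tooth and x + 1
    otherwise; its only cover is at index max(x + 1, k), the foot of the chain
    in the case of a tooth. *)
Definition maj_coef (k x y : nat) : nat :=
  (if x < k then 1 else x.+1) * (y == maxn x.+1 k).

Lemma inv_coef0 k x y : (y <= x) || (y < k) -> inv_coef k x y = 0.
Proof. rewrite /inv_coef; lia. Qed.

Lemma maj_coef0 k x y : (y <= x) || (y < k) -> maj_coef k x y = 0.
Proof. rewrite /maj_coef; case: eqP => //; lia. Qed.

Lemma inv_pair_stat n k (w : 'S_n) :
  Defs.inv (@label n k w) = pair_stat (inv_coef k) w.
Proof.
rewrite /Defs.inv -sum1_card /pair_stat exchange_big pair_big /= big_mkcond /=.
apply: eq_bigr => -[x y] _; rewrite !inE /= rake_ltE /inv_coef /label ltnS.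
by case: (_ && (k <= y)); case: (_ < _).
Qed.

Lemma rake_covers n k (x y : rake n k) :
  covers x y = ((y : 'I_n) == maxn (x : 'I_n).+1 k :> nat).
Proof.
rewrite /covers rake_ltE; apply/andP/eqP => [[/andP[xy ky]]|exy]; last first.
  split; first by lia.
  by apply/forallP => z; rewrite !rake_ltE; lia.
move/forallP => h.
have lt_m : maxn (x : 'I_n).+1 k < n by have := ltn_ord (y : 'I_n); lia.
have := h (Ordinal lt_m : rake n k); rewrite !rake_ltE /=; lia.
Qed.

Lemma rake_hook n k (x : rake n k) :
  hook_length x = if (x : 'I_n) < k then 1 else (x : 'I_n).+1.
Proof.
rewrite /hook_length; case: ltnP => [xk|kx].
  rewrite -(cards1 x); apply: eq_card => a; rewrite !inE le_eqVlt rake_ltE.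
  by rewrite (leqNgt k) xk andbF orbF.
have le_xn : (x : 'I_n).+1 <= n by apply: ltn_ord.
transitivity (\sum_(a < n | a < (x : 'I_n).+1) 1).
  rewrite sum1_card; apply: eq_card => a; rewrite !inE le_eqVlt rake_ltE kx.
  by rewrite andbT [RHS](leq_eqVlt a).
by rewrite -(big_ord_widen n (fun=> 1) le_xn) sum_nat_const card_ord muln1.
Qed.

Lemma maj_pair_stat n k (w : 'S_n) :
  maj (@label n k w) = pair_stat (maj_coef k) w.
Proof.
rewrite /maj /pair_stat exchange_big big_mkcond /=; apply: eq_bigr => x _.
rewrite rake_hook /descent; case: existsP => [[y /andP[]]|no].
  rewrite rake_covers /label ltnS => /eqP exy lt_w.
  rewrite (bigD1 y) //= lt_w /maj_coef exy eqxx !muln1 big1 ?addn0 // => z zy.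
  by rewrite -exy val_eqE (negbTE zy) /= muln0.
rewrite big1 // => y _; rewrite /maj_coef; case: eqP => [exy|_]; last first.
  by rewrite muln0.
case: (ltnP (w y)) => lt_w; last by rewrite muln0.
by case: no; exists y; rewrite rake_covers exy eqxx.
Qed.

(** * Removing the top element *)

Lemma bump_ltn a i j : (bump a i < bump a j) = (i < j).
Proof. rewrite /bump; lia. Qed.

Lemma bump_gtn a i : (a < bump a i) = (a <= i).
Proof. rewrite /bump; lia. Qed.

(** The labellings giving label j to element i are those of a rake with one
    element less: (j, s) |-> lift_perm i j s is injective between sets of the
    same size (n + 1)!. *)
Lemma sum_lift_perm (V : nmodType) n (i j : 'I_n.+1) (f : 'S_n.+1 -> V) :
  (\sum_(w : 'S_n.+1 | w i == j) f w = \sum_s f (lift_perm i j s))%R.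
Proof.
pose g (p : 'I_n.+1 * 'S_n) := lift_perm i p.1 p.2.
have g_inj : injective g.
  move=> [a s] [b t] /permP e; have := e i; rewrite !lift_perm_id => /= eab.
  subst b; congr pair; apply/permP => x; apply: (@lift_inj _ a).
  by have := e (lift i x); rewrite !lift_perm_lift.
have g_bij : bijective g.
  by apply: inj_card_bij => //; rewrite card_prod card_ord !card_Sn.
rewrite (reindex g) /=; last exact: onW_bij.
rewrite (eq_bigl (fun p => (p.1 == j) && true)); last first.
  by move=> p; rewrite /g lift_perm_id andbT.
by rewrite -(pair_big (pred1 j) predT (fun a s => f (g (a, s)))) /= big_pred1_eq.
Qed.

Lemma widen_lift_max n (i : 'I_n) : widen_ord (leqnSn n) i = lift ord_max i.
Proof. by apply: val_inj; rewrite [RHS]lift_max. Qed.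

(** Lifting is order preserving on the labels, so only the pairs involving the
    new top element contribute something new. *)
Lemma pair_stat_lift c n (a : 'I_n.+1) (s : 'S_n) :
  (forall x y, y <= x -> c x y = 0) ->
  pair_stat c (lift_perm ord_max a s)
  = pair_stat c s + \sum_(x < n) c x n * (a <= s x).
Proof.
move=> c0; rewrite /pair_stat big_ord_recr /=; congr addn.
  apply: eq_bigr => y _; rewrite big_ord_recr /= c0 ?addn0; last exact: ltnW.
  apply: eq_bigr => x _.
  by rewrite !widen_lift_max !lift_perm_lift /= bump_ltn.
rewrite big_ord_recr /= c0 // addn0; apply: eq_bigr => x _.
by rewrite !widen_lift_max lift_perm_lift lift_perm_id /= bump_gtn.
Qed.

Lemma card_perm_geq n a (s : 'S_n) : \sum_(x < n) (a <= s x) = n - a.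
Proof.
transitivity (\sum_(x < n) (a <= x)).
  by rewrite [RHS](reindex_inj (@perm_inj _ s)).
elim: n {s} => [|n IHn]; first by rewrite big_ord0.
rewrite big_ord_recr /= IHn; lia.
Qed.

(** Above the teeth, the top element lies over every other element. *)
Lemma inv_stat_lift k n (a : 'I_n.+1) (s : 'S_n) : k <= n ->
  pair_stat (inv_coef k) (lift_perm ord_max a s)
  = pair_stat (inv_coef k) s + (n - a).
Proof.
move=> kn; rewrite pair_stat_lift => [|x y yx]; last by rewrite inv_coef0 ?yx.
congr addn; rewrite -(card_perm_geq a s); apply: eq_bigr => x _.
by rewrite /inv_coef ltn_ord kn mul1n.
Qed.

(** When the chain already has an element, the new top element covers only the
    former top, whose hook length is n + 1. *)
Lemma maj_stat_lift k n (a : 'I_n.+2) (s : 'S_n.+1) : k <= n ->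
  pair_stat (maj_coef k) (lift_perm ord_max a s)
  = pair_stat (maj_coef k) s + n.+1 * (a <= s ord_max).
Proof.
move=> kn; rewrite pair_stat_lift => [|x y yx]; last by rewrite maj_coef0 ?yx.
congr addn; rewrite big_ord_recr /= big1 => [|x _].
  by rewrite add0n /maj_coef ltnNge kn /= (maxn_idPl _) ?eqxx ?muln1 // ltnW.
rewrite /maj_coef; case: eqP => [|_]; last by rewrite muln0.
have := ltn_ord x; lia.
Qed.

(** The lowest element of the chain covers each of the k teeth, all of hook
    length 1, so here maj and inv grow by the same amount. *)
Lemma maj_stat_lift_teeth k (a : 'I_k.+1) (s : 'S_k) :
  pair_stat (maj_coef k) (lift_perm ord_max a s)
  = pair_stat (maj_coef k) s + (k - a).
Proof.
rewrite pair_stat_lift => [|x y yx]; last by rewrite maj_coef0 ?yx.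
congr addn; rewrite -(card_perm_geq a s); apply: eq_bigr => x _.
by rewrite /maj_coef ltn_ord (maxn_idPr _) ?eqxx ?mul1n.
Qed.

Lemma pair_stat_teeth c k (s : 'S_k) :
  (forall x y, y < k -> c x y = 0) -> pair_stat c s = 0.
Proof.
move=> c0; rewrite /pair_stat big1 // => y _; rewrite big1 // => x _.
by rewrite c0.
Qed.

Local Open Scope ring_scope.

(** * q-integer identities *)

Section QInt.
Variable R : comNzRingType.

Lemma expr_double (x : R) m : x ^+ m.*2 = (x ^+ 2) ^+ m.
Proof. by rewrite -mul2n exprM. Qed.

Lemma sum_pairs (V : nmodType) m (f : nat -> V) :
  \sum_(b < m.*2) f b = \sum_(r < m) (f r.*2 + f r.*2.+1).
Proof.
elim: m => [|m IHm]; first by rewrite !big_ord0.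
by rewrite doubleS !big_ord_recr /= IHm addrA.
Qed.

Lemma qint_rev (p : R) h : \sum_(r < h) p ^+ (h - r.+1) = qint h p.
Proof. by rewrite /qint [RHS](reindex_inj rev_ord_inj). Qed.

Lemma qint_sub1 (x : R) h : (1 - x) * qint h x = 1 - x ^+ h.
Proof. by rewrite -[RHS]opprB subrX1 -mulNr opprB. Qed.

(** The exponents on the left fill the interval from h - i to 2h - i - 1.  The
    induction on i compares consecutive left sides, which differ in the single
    term r = i. *)
Lemma qint_shift (p : R) h i : (i <= h)%N ->
  \sum_(r < h) (if (r < i)%N then 1 else p ^+ h) * p ^+ (h - r.+1)
  = qint h p * p ^+ (h - i).
Proof.
elim: i => [_|i IHi lt_ih].
  by rewrite -mulr_sumr qint_rev subn0 mulrC.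
apply: (addIr (- (qint h p * p ^+ (h - i)))); rewrite -{1}IHi 1?ltnW // -sumrB.
rewrite (bigD1 (Ordinal lt_ih)) //= big1 => [|r]; last first.
  rewrite -val_eqE /= => ri; rewrite -mulrBl ltnS leq_eqVlt (negbTE ri) /=.
  by rewrite subrr mul0r.
rewrite ltnS leqnn ltnn addr0 -mulrBl -qint_sub1.
by rewrite -(subnSK lt_ih) exprS; ring.
Qed.

Lemma qint_doubleN (x : R) m : qint m.*2 (- x) = (1 - x) * qint m (x ^+ 2).
Proof.
rewrite /qint sum_pairs mulr_sumr; apply: eq_bigr => r _.
rewrite exprS !expr_double sqrrN; ring.
Qed.

(** This converts the factor (1 - x^(2m+1)) gained at an odd step, together with
    a q-integer in x^2, into two consecutive factors of the product. *)
Lemma qint_consecutive (x : R) m :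
  (1 - x ^+ m.*2.+1) * qint m.+1 (x ^+ 2)
  = qint m.*2.+1 x * qint m.*2.+2 (- x).
Proof. by rewrite -qint_sub1 -doubleS qint_doubleN; ring. Qed.

End QInt.

(** * The refinement by the label of the top element *)

Section TopLabel.
Variables (R : comNzRingType) (q : R) (k : nat).

Definition weight n (w : 'S_n) : R :=
  (-1) ^+ pair_stat (inv_coef k) w * q ^+ pair_stat (maj_coef k) w.

(** A labelling of the rake with n + 1 elements; its top label is read as a
    natural number so that a can range over expressions such as i.*2. *)
Definition last_sum n (a : nat) : R :=
  \sum_(w : 'S_n.+1 | w ord_max == a :> nat) weight w.

Lemma sum_weight n : \sum_(w : 'S_n.+1) weight w = \sum_(a < n.+1) last_sum n a.
Proof. by rewrite (partition_big (fun w : 'S_n.+1 => w ord_max) xpredT). Qed.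

Lemma last_sum_lift n (a : 'I_n.+1) :
  last_sum n a = \sum_(s : 'S_n) weight (lift_perm ord_max a s).
Proof. exact: sum_lift_perm. Qed.

Lemma last_sum_teeth (a : nat) : (a <= k)%N ->
  last_sum k a = (k`!)%:R * (- q) ^+ (k - a).
Proof.
rewrite -ltnS => ak; rewrite (last_sum_lift (Ordinal ak)) /=.
under eq_bigr => s _.
  rewrite /weight inv_stat_lift // maj_stat_lift_teeth.
  rewrite !pair_stat_teeth ?add0n => [|x y yk|x y yk]; last first.
  - by rewrite inv_coef0 ?yk ?orbT.
  - by rewrite maj_coef0 ?yk ?orbT.
  rewrite -exprMn mulN1r.
over.
by rewrite sumr_const card_Sn mulr_natl.
Qed.

(** Sort the labellings by the standardised label b of the former top: since b
    skips the value a, the former top carries a larger label than a iff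
    a <= b. *)
Lemma last_sum_rec n a : (k <= n)%N -> (a <= n.+1)%N ->
  last_sum n.+1 a
  = (-1) ^+ (n.+1 - a)
    * \sum_(b < n.+1) (if (b < a)%N then 1 else q ^+ n.+1) * last_sum n b.
Proof.
move=> kn; rewrite -ltnS => an; rewrite (last_sum_lift (Ordinal an)) /=.
rewrite (partition_big (fun s : 'S_n.+1 => s ord_max) xpredT) //= mulr_sumr.
apply: eq_bigr => b _; rewrite !mulr_sumr; apply: eq_bigr => s /eqP <-.
rewrite /weight inv_stat_lift ?maj_stat_lift ?leqW //= (exprD q) (exprD (-1)).
rewrite exprM.
by case: ltnP => _ /=; rewrite ?expr0 ?expr1; ring.
Qed.

Definition signed_prod n : R :=
  \prod_(k.+1 <= j < n.+1) qint j ((-1) ^+ j.-1 * q).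

Lemma signed_prodS n : (k <= n)%N ->
  signed_prod n.+1 = signed_prod n * qint n.+1 ((-1) ^+ n * q).
Proof. by move=> kn; rewrite /signed_prod big_nat_recr. Qed.

Lemma signed_prod_id : signed_prod k = 1.
Proof. by rewrite /signed_prod big_geq. Qed.

Definition even_entries_closed h := forall i, (i <= h)%N ->
  last_sum h.*2 i.*2 = (k`!)%:R * signed_prod h.*2 * q ^+ (h - i).*2.

(** The constant B depends on where the induction starts: it is k! (1 - q) if
    k = 2h + 1 and (1 - q^(2h+1)) k! times the product up to 2h if k <= 2h.
    Only its product with [h+1]_{q^2} has a uniform expression. *)
Definition pair_sums_closed h := exists2 B : R,
  forall i, (i <= h)%N ->
    last_sum h.*2.+1 i.*2 + last_sum h.*2.+1 i.*2.+1 = B * q ^+ (h - i).*2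
  & B * qint h.+1 (q ^+ 2) = (k`!)%:R * signed_prod h.*2.+2.

Lemma even_entries_teeth h : k = h.*2 -> even_entries_closed h.
Proof.
move=> kh i ih; rewrite -kh last_sum_teeth; last by lia.
have -> : (k - i.*2 = (h - i).*2)%N by lia.
by rewrite signed_prod_id mulr1 !expr_double sqrrN.
Qed.

Lemma pair_sums_teeth h : k = h.*2.+1 -> pair_sums_closed h.
Proof.
move=> kh; exists ((k`!)%:R * (1 - q)) => [i ih|].
  rewrite -kh !last_sum_teeth; try lia.
  have -> : (k - i.*2 = (h - i).*2.+1)%N by lia.
  have -> : (k - i.*2.+1 = (h - i).*2)%N by lia.
  by rewrite exprS !expr_double sqrrN; ring.
have sgn : (-1) ^+ k = -1 :> R by rewrite -signr_odd kh /= odd_double.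
rewrite -kh signed_prodS // signed_prod_id mul1r sgn mulN1r.
have -> : k.+1 = h.+1.*2 by lia.
by rewrite qint_doubleN mulrA.
Qed.

(** Entries 2i and 2i + 1 of the recursion have opposite signs, and their
    coefficients differ only at b = 2i. *)
Lemma pair_sums_step h : (k <= h.*2)%N ->
  even_entries_closed h -> pair_sums_closed h.
Proof.
move=> kh ev; exists ((1 - q ^+ h.*2.+1) * ((k`!)%:R * signed_prod h.*2)).
  move=> i ih; rewrite -[RHS]mulrA -ev //.
  rewrite !last_sum_rec ?leqnn; try lia.
  have lt_ih : (i.*2 < h.*2.+1)%N by lia.
  rewrite subSS -doubleB subSn; last by lia.
  rewrite -doubleB exprS !(expr_double (-1)) sqrrN !expr1n mulr1.
  rewrite mul1r mulN1r addrC -sumrB (bigD1 (Ordinal lt_ih)) //= big1 => [|b].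
    by rewrite ltnS leqnn ltnn addr0 -mulrBl.
  rewrite -val_eqE /= => bi; rewrite -mulrBl ltnS leq_eqVlt (negbTE bi) /=.
  by rewrite subrr mul0r.
rewrite mulrAC qint_consecutive !signed_prodS ?leqW //.
by rewrite exprS expr_double sqrrN !expr1n mulr1 mulN1r mul1r; ring.
Qed.

(** The coefficient in the recursion for an even entry is constant on each pair
    {2r, 2r+1}, so only the pair sums matter, and they are summed by
    qint_shift. *)
Lemma even_entries_step h : (k <= h.*2.+1)%N ->
  pair_sums_closed h -> even_entries_closed h.+1.
Proof.
move=> kh [B pairE BE] i ih; rewrite doubleS -BE last_sum_rec //; last by lia.
have -> : (h.*2.+2 - i.*2 = (h.+1 - i).*2)%N by lia.
rewrite (expr_double (-1)) sqrrN !expr1n mul1r.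
rewrite -doubleS (sum_pairs h.+1
  (fun b => (if (b < i.*2)%N then 1 else _) * last_sum _ b)).
rewrite !(expr_double q) -mulrA -qint_shift // mulr_sumr.
apply: eq_bigr => r _.
have -> : (r.*2.+1 < i.*2)%N = (r < i)%N by lia.
have -> : (r.*2 < i.*2)%N = (r < i)%N by lia.
rewrite -mulrDr pairE; last by rewrite -ltnS.
by rewrite expr_double subSS; ring.
Qed.

Lemma even_entriesP h : (k <= h.*2)%N -> even_entries_closed h.
Proof.
elim: h => [|h IHh] kh; first by apply: even_entries_teeth; lia.
have [kh0|kh0|] := ltngtP k h.*2.+1.
- by apply: even_entries_step; [lia | apply: pair_sums_step => //; apply: IHh].
- by apply: even_entries_teeth; lia.
- by move=> kh1; apply: even_entries_step; [lia | apply: pair_sums_teeth].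
Qed.

Lemma pair_sumsP h : (k <= h.*2.+1)%N -> pair_sums_closed h.
Proof.
rewrite leq_eqVlt => /predU1P[|kh]; first exact: pair_sums_teeth.
by apply: pair_sums_step => //; apply: even_entriesP.
Qed.

Lemma sum_weight_even h : (k <= h.*2.+1)%N ->
  \sum_(w : 'S_h.*2.+2) weight w = (k`!)%:R * signed_prod h.*2.+2.
Proof.
move=> /pair_sumsP[B pairE <-]; rewrite sum_weight -doubleS sum_pairs.
rewrite -qint_rev mulr_sumr; apply: eq_bigr => r _.
by rewrite pairE ?subSS ?expr_double // -ltnS.
Qed.

End TopLabel.

(** * Passing from labellings to orbits *)

(** S_k acts freely, being a group of translations of S_n. *)
Lemma card_relabel_orbit n k (w : 'S_n) : (k <= n)%N ->
  #|orbit (relabel_action n) (Sym (teeth n k)) w| = k`!.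
Proof.
move=> kn; rewrite card_in_imset => [|s t _ _]; last first.
  by move/mulIg/invg_inj.
rewrite card_Sym; congr factorial.
rewrite -[RHS]card_ord -[RHS]sum1_card (big_ord_widen n (fun=> 1%N) kn).
rewrite sum1_card.
by apply: eq_card => x; rewrite inE.
Qed.

Lemma sum_rake_orbits (V : nmodType) n k (f : {set 'S_n} -> V) (g : 'S_n -> V) :
  (k <= n)%N ->
  (forall O w, O \in rake_orbits n k -> w \in O -> f O = g w) ->
  (\sum_(O in rake_orbits n k) f O) *+ k`! = \sum_w g w.
Proof.
move=> kn fg.
have part : partition (rake_orbits n k) [set: 'S_n].
  have -> : rake_orbits n k
      = [set orbit (relabel_action n) (Sym (teeth n k)) w | w in [set: 'S_n]].
    by apply/setP => O; apply/imsetP/imsetP => -[w _ ->]; exists w.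
  by apply: orbit_partition; apply/actsP => s _ w; rewrite !inE.
rewrite [RHS](eq_bigl (fun w => w \in [set: 'S_n])); last first.
  by move=> w; rewrite inE.
rewrite (set_partition_big _ part) /= -sumrMnl; apply: eq_bigr => O Oin.
transitivity (\sum_(w in O) f O); last first.
  by apply: eq_bigr => w wO; apply: fg.
rewrite sumr_const; congr (_ *+ _).
by case/imsetP: Oin => w _ ->; rewrite card_relabel_orbit.
Qed.

Theorem proposition4p3 (n k : nat) (n_gt0 : (0 < n)%N) (n_even : ~~ odd n)
    (k_lt_n : (k < n)%N) :
  \sum_(O in rake_orbits n k) (-1) ^+ rake_inv k O * 'X ^+ rake_maj k O
  = \prod_(k.+1 <= j < n.+1) qint j ((-1) ^+ j.-1 * 'X) :> {poly int}.
Proof.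
have fact_neq0 : (k`!)%:R != 0 :> {poly int}.
  by rewrite -polyC_natr polyC_eq0 pnatr_eq0 -lt0n fact_gt0.
apply: (mulfI fact_neq0); rewrite mulr_natl.
rewrite (sum_rake_orbits (g := @weight _ 'X k n)) ?(ltnW k_lt_n) //.
  have [h en] : exists h, n = h.*2.+2 by exists n./2.-1; lia.
  by subst n; rewrite sum_weight_even.
move=> O w Oin wO; rewrite /weight -inv_pair_stat -maj_pair_stat.
by rewrite (rake_invE Oin wO) (rake_majE Oin wO).
Qed.
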